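(* Let $\eta\in[0,2\pi)$, let $d\ge1$ and $q\ge2$ be integers, and let $G$ be a mixed Hamming graph $H(d,q)$ equipped with its $\eta$-function $\theta$. If $G$ is periodic, then $(d,q)=(2^f,2)$ or $(d,q)=(3^f,3)$ for some non-negative integer $f$.
   Context: A mixed graph $G=(V,\mathcal{A})$ consists of a finite vertex set $V$ and a subset $\mathcal{A} \subset V\times V \setminus \{(x,x) \mid x\in V\}$ of arcs. For an arc $a=(x,y)$, write $o(a)=x$, $t(a)=y$, $a^{-1}=(y,x)$. Let $\mathcal{A}^{-1}=\{a^{-1} \mid a\in\mathcal{A}\}$ and $\mathcal{A}^{\pm}=\mathcal{A}\cup\mathcal{A}^{-1}$. The underlying graph $G^{\pm}=(V,\mathcal{A}^{\pm})$ is regarded as an undirected simple graph, and $\deg_G x=\deg_{G^{\pm}}x$. The Hamming graph $H(d,q)$ has as vertices the words of length $d$ over an alphabet of size $q$, two words being adjacent when they differ in exactly one coordinate. A mixed graph $G$ is a mixed Hamming graph $H(d,q)$ if $G^{\pm}$ is isomorphic to $H(d,q)$. The $\eta$-function $\theta:\mathcal{A}^{\pm}\to\mathbb{R}$ of $G$ is defined by $\theta(a)=\eta$ if $a\in\mathcal{A}\setminus\mathcal{A}^{-1}$, $\theta(a)=-\eta$ if $a\in\mathcal{A}^{-1}\setminus\mathcal{A}$, and $\theta(a)=0$ if $a\in\mathcal{A}\cap\mathcal{A}^{-1}$. Define $K\in\mathbb{C}^{V\times\mathcal{A}^{\pm}}$ by $K_{x,a}=\frac{1}{\sqrt{\deg_G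 x}}\delta_{x,t(a)}$, $C=2K^*K-I$, $(S_\theta)_{a,b}=e^{\theta(b)i}\delta_{a,b^{-1}}$ for $a,b\in\mathcal{A}^{\pm}$, and the time evolution matrix $U_\theta=S_\theta C\in\mathbb{C}^{\mathcal{A}^{\pm}\times\mathcal{A}^{\pm}}$. The mixed graph $G$ (equipped with $\theta$) is periodic if there is a positive integer $\tau$ with $U_\theta^{\tau}=I$. *)

(* Defs.v *)
From HB Require Import structures.
From mathcomp Require Export all_boot all_order all_algebra.
From mathcomp Require Export spectral complex.
From mathcomp Require Export reals trigo.

Set Implicit Arguments.
Unset Strict Implicit.
Unset Printing Implicit Defensive.

Import Order.TTheory GRing.Theory Num.Theory.

Local Open Scope ring_scope.
Local Open Scope complex_scope.
Local Open Scope sesquilinear_scope.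

Record mixed_graph := MixedGraph {
  vertex :> finType;
  arcs : {set vertex * vertex};
  arcs_loopless : forall x : vertex, (x, x) \notin arcs
}.

Definition ainv (V : Type) (a : V * V) : V * V := (a.2, a.1).

Section MixedGraphs.
Variable G : mixed_graph.

Definition inv_arcs : {set G * G} := [set ainv a | a in arcs G].

Definition sym_arcs : {set G * G} := arcs G :|: inv_arcs.

(* Index type of the matrices: each undirected edge contributes both of its
   orientations. *)
Definition sym_arc : finType := {a : G * G | a \in sym_arcs}.

Definition adj : rel G := fun x y => (x, y) \in sym_arcs.

Definition deg (x : G) : nat := #|[set y | adj x y]|.

End MixedGraphs.

Definition word (d q : nat) : finType := {ffun 'I_d -> 'I_q}.

Definition hamming_adj (d q : nat) : rel (word d q) :=
  fun x y => #|[set i | x i != y i]| == 1%N.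

Definition isomorphic_graphs (V W : Type) (e : rel V) (e' : rel W) : Prop :=
  exists2 f : V -> W, bijective f & forall x y : V, e x y = e' (f x) (f y).

Definition mixed_hamming (d q : nat) (G : mixed_graph) : Prop :=
  isomorphic_graphs (@adj G) (@hamming_adj d q).

Section TimeEvolution.
Variables (R : realType) (G : mixed_graph).

Definition eta_function (eta : R) (a : sym_arc G) : R :=
  if val a \in arcs G :\: inv_arcs G then eta
  else if val a \in inv_arcs G :\: arcs G then - eta
  else 0.

(* e^{t i}; the library has no complex exponential. *)
Definition expi (t : R) : R[i] := cos t +i* sin t.

(* A matrix with rows indexed by I and columns by J, transported to ordinals by
   the canonical enumerations; using the same enumeration on both sides of a
   square matrix makes products and powers agree with those over I. *)
Definition fin_mx (I J : finType) (f : I -> J -> R[i]) : 'M[R[i]]_(#|I|, #|J|) :=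
  \matrix_(i, j) f (enum_val i) (enum_val j).

Definition K_mx : 'M[R[i]]_(#|G|, #|sym_arc G|) :=
  fin_mx (fun x (a : sym_arc G) =>
    (sqrtC (deg x)%:R)^-1 * (x == (val a).2)%:R).

Definition C_mx : 'M[R[i]]_#|sym_arc G| := 2 *: (K_mx ^t* *m K_mx) - 1%:M.

Definition S_mx (theta : sym_arc G -> R) : 'M[R[i]]_#|sym_arc G| :=
  fin_mx (fun a b : sym_arc G =>
    expi (theta b) * (val a == ainv (val b))%:R).

Definition U_mx (theta : sym_arc G -> R) : 'M[R[i]]_#|sym_arc G| :=
  S_mx theta *m C_mx.

Definition periodic (theta : sym_arc G -> R) : Prop :=
  exists2 tau : nat, (0 < tau)%N & U_mx theta ^+ tau = 1%:M.

End TimeEvolution.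

(* Main.v *)
Require Import Defs.
From mathcomp Require Import mxpoly algC algnum ring.

(** Write k = d (q - 1) for the common degree of G and n = q ^ d for its number
    of vertices, and let T = K S K^* be the discriminant of the walk; it is the
    Hermitian adjacency matrix of G divided by k.

    Since S and C are involutions and K C = K, an eigenvector v of T with
    eigenvalue a lifts to w = v K, which satisfies
    w (U^2 - 2 a U + 1) = 0; so 2 a = u + u^-1 for an eigenvalue u of U
    (walk_eigenvalue_lift). When U has finite order, u is a root of unity, and
    every eigenvalue of 2 T is an algebraic integer. The second elementary
    symmetric function of these eigenvalues is then an algebraic integer too.
    It equals half of (tr 2T)^2 - tr (2T)^2. The diagonal of T vanishes because
    G has no loops, and tr T^2 = n / k because opposite arcs carry conjugate
    phases, so this number is - 2 n / k. Being rational, it is an integer: k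
    divides 2 n (periodic_regular_dvdn, for any regular mixed graph).

    For Hamming graphs this reads d (q - 1) | 2 q ^ d. As q - 1 is prime to q,
    it divides 2, so q is 2 or 3, and then d divides 2 ^ (d + 1) or 3 ^ d
    (hamming_parameters). *)

Set Implicit Arguments.
Unset Strict Implicit.
Unset Printing Implicit Defensive.

Import Order.TTheory GRing.Theory Num.Theory.

Local Open Scope ring_scope.
Local Open Scope complex_scope.
Local Open Scope sesquilinear_scope.

(** * Algebraic integers *)

Definition algebraic_integer (F : nzRingType) (x : F) : Prop :=
  integralOver (intr : int -> F) x.

(** A rational algebraic integer is an integer. The monic polynomial has
    integer coefficients, so it can be evaluated at the same rational number
    inside [algC], whose rational algebraic integers are known to be integers. *)
Lemma algebraic_integer_ratio_dvdn (F : numFieldType) (m k : nat) :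
  (0 < k)%N -> algebraic_integer (m%:R / k%:R : F) -> (k %| m)%N.
Proof.
move=> k_gt0 [p p_monic].
have -> : m%:R / k%:R = ratr (m%:R / k%:R) :> F.
  by rewrite [RHS]fmorph_div /= !ratr_nat.
have -> : map_poly intr p
        = map_poly ratr (map_poly intr p : {poly rat}) :> {poly F}.
  by rewrite -map_poly_comp; apply: eq_map_poly => z /=; rewrite ratr_int.
rewrite fmorph_root -(fmorph_root (ratr : rat -> algC)) -map_poly_comp.
rewrite (eq_map_poly (g := intr)); last by move=> z /=; rewrite ratr_int.
move=> /root_monic_Aint-/(_ (monic_map _ p_monic)) intx.
have {intx} : (ratr (m%:R / k%:R) : algC) \in Aint.
  by apply: intx; apply/polyOverP => i; rewrite coef_map /= intr_int.
move=> /(Cint_rat_Aint (Crat_rat _))/intrP[z].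
have k_neq0 : k%:R != 0 :> algC by rewrite pnatr_eq0 -lt0n.
rewrite [LHS]fmorph_div /= !ratr_nat => /(canRL (divfK k_neq0)) mE.
have mzE : m%:Z = z * k%:Z.
  by apply: (intr_inj (R := algC)); rewrite intrM -!pmulrn.
by have : (k%:Z %| m%:Z)%Z; [rewrite mzE dvdz_mull | rewrite dvdzE].
Qed.

Lemma algebraic_integer_unity_root (F : numFieldType) (n : nat) (u : F) :
  (0 < n)%N -> u ^+ n = 1 -> algebraic_integer u.
Proof.
move=> n_gt0 un1; exists ('X^n - 1); first by rewrite monicXnsubC.
by rewrite rmorphB rmorph1 /= map_polyXn rootE !hornerE un1 subrr.
Qed.

(** The witness is the second elementary symmetric function of the x i, built
    by adjoining one variable at a time so that its integrality is immediate. *)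
Lemma half_sqr_sum_sub_sum_sqr (F : numFieldType) n (x : 'I_n -> F) :
    (forall i, algebraic_integer (x i)) ->
  exists2 e, algebraic_integer e &
    (\sum_i x i) ^+ 2 - \sum_i x i ^+ 2 = 2 * e.
Proof.
elim: n x => [|n IHn] x int_x.
  by exists 0; rewrite ?big_ord0 ?expr0n ?subrr ?mulr0 //; apply: integral0.
have [e int_e eE] := IHn _ (fun i => int_x (lift ord_max i)).
exists (e + (\sum_i x (lift ord_max i)) * x ord_max).
  apply: integral_add => //; apply: integral_mul; last exact: int_x.
  apply: big_ind => [|y z|i _]; first exact: integral0.
    exact: integral_add.
  exact: int_x.
have lift_widen (i : 'I_n) : lift ord_max i = widen_ord (leqnSn n) i.
  by apply: val_inj; apply: lift_max.
rewrite !big_ord_recr /=.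
under eq_bigr do rewrite -lift_widen.
under [X in _ - (X + _)]eq_bigr do rewrite -lift_widen.
rewrite mulrDr -eE; ring.
Qed.

(** * Eigenvalues *)

(** The second coefficient of the characteristic polynomial, read off from the
    traces of A and A^2. Diagonalizing A turns the hypothesis on eigenvectors
    into one on the entries of a diagonal matrix, listed with multiplicity. *)
Lemma half_trace_sqr_integral (F : numClosedFieldType) n (A : 'M[F]_n) :
    A ^t* = A ->
    (forall (a : F) (v : 'rV_n), v != 0 -> v *m A = a *: v ->
       algebraic_integer a) ->
  exists2 e, algebraic_integer e & (\tr A) ^+ 2 - \tr (A *m A) = 2 * e.
Proof.
move=> A_herm int_eig.
have /orthomx_spectralP : A \is normalmx by apply/normalmxP; rewrite A_herm.
have := spectral_unit A; move: (spectralmx A) (spectral_diag A) => P D Pu AE.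
have PA : P *m A = diag_mx D *m P by rewrite AE !mulmxA mulmxV // mul1mx.
have trE B : \tr (invmx P *m B *m P) = \tr B.
  by rewrite -mulmxA mxtrace_mulC mulmxK.
have int_D i : algebraic_integer (D 0 i).
  apply: (int_eig _ (row i P)).
    apply: contraTneq Pu => Pi0; rewrite unitmxE unitfE negbK.
    rewrite (expand_det_row _ i) big1 // => j _.
    by have /rowP/(_ j) := Pi0; rewrite !mxE => ->; rewrite mul0r.
  by rewrite -row_mul PA; apply/rowP => j; rewrite mxE mul_diag_mx !mxE.
have [e int_e eE] := half_sqr_sum_sub_sum_sqr int_D; exists e => //; rewrite -eE.
have -> : A *m A = invmx P *m (diag_mx D *m diag_mx D) *m P.
  by rewrite {1}AE -!mulmxA PA !mulmxA.
rewrite {1}AE !trE mxtrace_diag; congr (_ - _).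
rewrite mulmx_diag mxtrace_diag; apply: eq_bigr => i _.
by rewrite !mxE expr2.
Qed.

Lemma eigenvalue_finite_order (F : fieldType) m (U : 'M[F]_m) n (u : F)
    (w : 'rV_m) :
  U ^+ n = 1%:M -> w != 0 -> w *m U = u *: w -> u ^+ n = 1.
Proof.
move=> Un1 w_neq0 wU.
have wUn k : w *m U ^+ k = u ^+ k *: w.
  elim: k => [|k IHk]; first by rewrite !expr0 mulmx1 scale1r.
  by rewrite exprSr -mulmxE mulmxA IHk -scalemxAl wU scalerA -exprSr.
move: (wUn n); rewrite Un1 mulmx1 => /eqP.
rewrite -subr_eq0 -{1}[w]scale1r -scalerBl scaler_eq0 (negPf w_neq0) orbF.
by rewrite subr_eq0 => /eqP.
Qed.

(** Put U = S C and w = v K. From K C = K and S^2 = C^2 = 1 one gets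
    w U + w U^-1 = 2 a w, with w U^-1 = w S. If u is a root of
    X^2 - 2 a X + 1, then w (U - u) (U - u^-1) = 0, so either w is an
    eigenvector of U for u, or w (U - u) is one for u^-1. In both cases u is a
    root of unity, and 2 a = u + u^-1. *)
Lemma walk_eigenvalue_lift (F : numClosedFieldType) n m (K : 'M[F]_(n, m))
    (S : 'M[F]_m) (tau : nat) (a : F) (v : 'rV_n) :
    K *m K ^t* = 1%:M -> S *m S = 1%:M -> (0 < tau)%N ->
    (S *m (2 *: (K ^t* *m K) - 1%:M)) ^+ tau = 1%:M ->
    v != 0 -> v *m (K *m S *m K ^t*) = a *: v ->
  algebraic_integer (2 * a).
Proof.
move=> KK SS tau_gt0; set C := _ - _; set U := S *m C => Utau v_neq0 vT.
have KC : K *m C = K.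
  rewrite /C mulmxBr -scalemxAr mulmxA KK mul1mx mulmx1.
  by rewrite scaler_nat mulr2n addrK.
have CC : C *m C = 1%:M.
  by rewrite {1}/C mulmxBl mul1mx -scalemxAl -mulmxA KC /C opprB addrC subrK.
pose w := v *m K.
have w_neq0 : w != 0.
  apply: contraNneq v_neq0 => w0.
  by rewrite -[v]mulmx1 -KK mulmxA -/w w0 mul0mx.
have wUw : w *m U + w *m S = (2 * a) *: w.
  rewrite /w /U /C !(mulmxA, mulmxBr) -scalemxAr mulmx1 subrK.
  by rewrite -scalerA (scalemxAl a) -vT !mulmxA.
have wSU : w *m S *m U = w.
  by rewrite /U !mulmxA -(mulmxA w) SS mulmx1 /w -mulmxA KC.
have [u uE] : exists u : F, u ^+ 2 = 2 * a * u - 1.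
  have [u uE] := solve_monicpoly (fun i => if i is 0%N then -1 else 2 * a)
                   (ltn0Sn 1).
  by exists u; rewrite uE !big_ord_recl big_ord0 /= mulr1 expr1 addr0 addrC.
have u_neq0 : u != 0.
  apply/eqP => u0; move/eqP: uE.
  by rewrite u0 expr0n mulr0 sub0r eq_sym oppr_eq0 oner_eq0.
have aE : 2 * a = u + u^-1.
  by apply: (mulIf u_neq0); rewrite [RHS]mulrDl mulVf // -expr2 uE subrK.
suff u_order : u ^+ tau = 1.
  rewrite aE; apply: integral_add.
    exact: (algebraic_integer_unity_root tau_gt0 u_order).
  apply: (algebraic_integer_unity_root tau_gt0).
  by rewrite exprVn u_order invr1.
have [wUu|w'_neq0] := eqVneq (w *m U - u *: w) 0.
  apply: (eigenvalue_finite_order Utau w_neq0).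
  by apply/eqP; rewrite -subr_eq0 wUu.
have w'E : w *m U - u *: w = u^-1 *: w - w *m S.
  rewrite -[w *m U](addrK (w *m S)) wUw aE scalerDl.
  by rewrite addrAC [u *: w + _]addrC addrK.
have w'U : (w *m U - u *: w) *m U = u^-1 *: (w *m U - u *: w).
  by rewrite {1}w'E mulmxBl -scalemxAl wSU scalerBr scalerA mulVf // scale1r.
have /(congr1 GRing.inv) := eigenvalue_finite_order Utau w'_neq0 w'U.
by rewrite exprVn invrK invr1.
Qed.

(** * Matrices indexed by finite types *)

Lemma fin_mx_mul (R : realType) (I J L : finType) (f : I -> J -> R[i])
    (g : J -> L -> R[i]) :
  fin_mx f *m fin_mx g = fin_mx (fun i l => \sum_j f i j * g j l).
Proof.
apply/matrixP => i l; rewrite !mxE [RHS]big_enum_val.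
by apply: eq_bigr => j _; rewrite !mxE.
Qed.

Lemma fin_mx_adjoint (R : realType) (I J : finType) (f : I -> J -> R[i]) :
  (fin_mx f) ^t* = fin_mx (fun j i => (f i j)^*%R).
Proof. by apply/matrixP => i j; rewrite !mxE. Qed.

Lemma eq_fin_mx (R : realType) (I J : finType) (f g : I -> J -> R[i]) :
  f =2 g -> fin_mx f = fin_mx g.
Proof. by move=> fg; apply/matrixP => i j; rewrite !mxE fg. Qed.

Lemma fin_mx_id (R : realType) (I : finType) :
  fin_mx (fun i j : I => (i == j)%:R : R[i]) = 1%:M.
Proof.
by apply/matrixP => i j; rewrite !mxE (inj_eq enum_val_inj).
Qed.

Lemma fin_mx_trace (R : realType) (I : finType) (f : I -> I -> R[i]) :
  \tr (fin_mx f) = \sum_i f i i.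
Proof.
rewrite [RHS]big_enum_val.
by apply: eq_bigr => i _; rewrite mxE.
Qed.

(** * Arcs and phases *)

Lemma conj_expi (R : realType) (t : R) : (expi t)^*%R = expi (- t).
Proof. by rewrite /expi cosN sinN. Qed.

Lemma expi_mulN (R : realType) (t : R) : expi t * expi (- t) = 1.
Proof.
rewrite /expi cosN sinN; apply/eqP; rewrite eq_complex /=.
by rewrite mulrN opprK -!expr2 cos2Dsin2 eqxx mulrN mulrC addrC subrr eqxx.
Qed.

Lemma ainvK (V : Type) : involutive (@ainv V).
Proof. by case. Qed.

Lemma mem_inv_arcs (G : mixed_graph) (p : G * G) :
  (p \in inv_arcs G) = (ainv p \in arcs G).
Proof. by rewrite -{1}[p]ainvK mem_imset //; apply: inv_inj (@ainvK _). Qed.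

Lemma mem_sym_arcs_ainv (G : mixed_graph) (p : G * G) :
  (ainv p \in sym_arcs G) = (p \in sym_arcs G).
Proof.
by rewrite !in_setU !mem_inv_arcs ainvK orbC.
Qed.

Lemma adjC (G : mixed_graph) (x y : G) : adj x y = adj y x.
Proof. exact: mem_sym_arcs_ainv (y, x). Qed.

Lemma adj_irrefl (G : mixed_graph) (x : G) : adj x x = false.
Proof.
by rewrite /adj in_setU mem_inv_arcs (negPf (arcs_loopless x)).
Qed.

Lemma sum_sym_arc (R : realType) (G : mixed_graph) (F : G * G -> R[i]) :
  \sum_(a : sym_arc G) F (val a) = \sum_(p in sym_arcs G) F p.
Proof. by rewrite [RHS]big_sub. Qed.

(** * The discriminant of the walk

    The phase g changes sign with the orientation of an arc. It is given on all
    pairs of vertices, so that sums over the arcs can be handled as sums over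
    pairs. *)

Section OddPhase.
Variables (R : realType) (G : mixed_graph) (g : G * G -> R).
Hypothesis g_odd : forall p, g (ainv p) = - g p.
Hypothesis deg_gt0 : forall x : G, (0 < deg x)%N.

Let theta (a : sym_arc G) : R := g (val a).
Let K := K_mx R G.
Let S := S_mx theta.
Let s (x : G) : R[i] := (sqrtC (deg x)%:R)^-1.

Let s_conj x : (s x)^*%R = s x.
Proof. by apply: geC0_conj; rewrite invr_ge0 sqrtC_ge0 ler0n. Qed.

Let s_sqr x : s x * s x = (deg x)%:R^-1.
Proof. by rewrite /s -invfM -expr2 sqrtCK. Qed.

(** The row of x is supported on the deg x arcs that end at x, and the
    normalization makes it a unit vector; rows of distinct vertices have
    disjoint supports. *)
Lemma K_mx_coisometry : K *m K ^t* = 1%:M.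
Proof.
rewrite /K /K_mx fin_mx_adjoint fin_mx_mul -fin_mx_id; apply: eq_fin_mx => x y.
pose F (p : G * G) : R[i] := s x * (x == p.2)%:R * (s y * (y == p.2)%:R).
transitivity (\sum_(p in sym_arcs G) F p).
  rewrite -sum_sym_arc; apply: eq_bigr => a _.
  by rewrite rmorphM /= -/(s y) s_conj conjC_nat.
have -> : \sum_(p in sym_arcs G) F p = \sum_u \sum_(v | adj u v) F (u, v).
  by rewrite pair_big_dep; apply: eq_big => [[u v]|[u v] _].
rewrite (exchange_big_dep predT) //= (bigD1 x) //=.
rewrite [X in _ + X]big1 => [|v /negPf v_neq_x].
  rewrite addr0 /F /= eqxx mulr1; have [->|y_neq_x] := eqVneq y x.
    rewrite mulr1 s_sqr sumr_const -[LHS]mulr_natr.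
    have -> : #|[pred u | adj u x]| = deg x.
      by rewrite /deg cardsE; apply: eq_card => u; rewrite !inE adjC.
    by rewrite mulVf // pnatr_eq0 -lt0n deg_gt0.
  by rewrite big1 // => u _; rewrite !mulr0.
by rewrite big1 // => u _; rewrite /F /= eq_sym v_neq_x mulr0 mul0r.
Qed.

(** S pairs each arc with its inverse, and the two phases cancel. *)
Lemma S_mx_involutive : S *m S = 1%:M.
Proof.
rewrite /S /S_mx fin_mx_mul -fin_mx_id; apply: eq_fin_mx => a c.
pose F p : R[i] :=
  expi (g p) * (val a == ainv p)%:R *
  (expi (g (val c)) * (p == ainv (val c))%:R).
transitivity (\sum_(p in sym_arcs G) F p); first by rewrite -sum_sym_arc.
rewrite (bigD1 (ainv (val c))) ?mem_sym_arcs_ainv ?(valP c) //=.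
rewrite big1 => [|p /andP[_]].
  rewrite addr0 /F eqxx ainvK mulr1 g_odd mulrAC [expi _ * _]mulrC.
  by rewrite expi_mulN mul1r.
by rewrite /F => /negPf->; rewrite !mulr0.
Qed.

(** The discriminant is the normalized Hermitian adjacency matrix: K selects
    the target of an arc on one side and, after S reverses it, its origin on
    the other, so that the arc (x, y) alone contributes to the entry (x, y). *)
Lemma discriminantE :
  K *m S *m K ^t* =
    fin_mx (fun x y => s x * s y * expi (g (x, y)) * (adj x y)%:R).
Proof.
rewrite /K /K_mx /S /S_mx fin_mx_adjoint !fin_mx_mul; apply: eq_fin_mx => x y.
pose F p : R[i] := s x * expi (g p) * (x == p.1)%:R * (s y * (y == p.2)%:R).
transitivity (\sum_(p in sym_arcs G) F p).
  rewrite -sum_sym_arc; apply: eq_bigr => b _.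
  rewrite rmorphM /= -/(s y) s_conj conjC_nat; congr (_ * _).
  pose H p : R[i] :=
    s x * (x == p.2)%:R * (expi (g (val b)) * (p == ainv (val b))%:R).
  transitivity (\sum_(p in sym_arcs G) H p); first by rewrite -sum_sym_arc.
  rewrite (bigD1 (ainv (val b))) ?mem_sym_arcs_ainv ?(valP b) //=.
  rewrite big1 => [|p /andP[_]].
    by rewrite addr0 /H eqxx mulr1 mulrAC.
  by rewrite /H => /negPf->; rewrite !mulr0.
have F0 p : p != (x, y) -> F p = 0.
  case: p => u v; rewrite -pair_eqE /= negb_and ![_ == x]eq_sym ![_ == y]eq_sym.
  by case/orP => [/negPf|/negPf] xyE; rewrite /F /= xyE !(mulr0, mul0r).
have [xy|xy] := boolP (adj x y).
  rewrite (bigD1 (x, y)) //= big1 => [|p /andP[_ /F0] //].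
  by rewrite addr0 /F /= !eqxx !mulr1 mulrAC.
rewrite mulr0 big1 // => p p_arc; apply: F0.
by apply: contraNneq xy => pE; rewrite /adj -pE.
Qed.

Lemma discriminant_hermitian : (K *m S *m K ^t*) ^t* = K *m S *m K ^t*.
Proof.
rewrite discriminantE fin_mx_adjoint; apply: eq_fin_mx => x y.
rewrite !rmorphM /= !s_conj conjC_nat conj_expi -g_odd adjC.
by rewrite [s y * _]mulrC.
Qed.

Lemma discriminant_trace : \tr (K *m S *m K ^t*) = 0.
Proof.
by rewrite discriminantE fin_mx_trace big1 // => x _; rewrite adj_irrefl mulr0.
Qed.

Lemma discriminant_sqr_trace :
  \tr ((K *m S *m K ^t*) *m (K *m S *m K ^t*)) =
    \sum_(x : G) \sum_(y | adj x y) (deg x)%:R^-1 * (deg y)%:R^-1.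
Proof.
rewrite discriminantE fin_mx_mul fin_mx_trace; apply: eq_bigr => x _.
rewrite [RHS]big_mkcond; apply: eq_bigr => y _.
rewrite adjC -/(ainv (x, y)) g_odd; case: adj; last by rewrite !mulr0.
rewrite !mulr1 mulrACA expi_mulN mulr1.
by rewrite [s y * _]mulrC mulrACA !s_sqr.
Qed.

End OddPhase.

(** * Periodic regular mixed graphs *)

(** The second coefficient of the characteristic polynomial of 2 T is
    - 2 #|G| / k, and it is an algebraic integer by periodicity. *)
Lemma periodic_regular_dvdn (R : realType) (eta : R) (G : mixed_graph)
    (k : nat) :
    (0 < k)%N -> (forall x : G, deg x = k) -> periodic (@eta_function R G eta) ->
  (k %| 2 * #|G|)%N.
Proof.
move=> k_gt0 degE [tau tau_gt0 Utau].
(* [eta_function], extended to all pairs of vertices. *)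
pose g (p : G * G) : R := if p \in arcs G :\: inv_arcs G then eta
  else if p \in inv_arcs G :\: arcs G then - eta else 0.
have g_odd p : g (ainv p) = - g p.
  rewrite /g !in_setD !mem_inv_arcs ainvK.
  by case: (p \in arcs G); case: (ainv p \in arcs G); rewrite /= ?opprK ?oppr0.
have deg_gt0 (x : G) : (0 < deg x)%N by rewrite degE.
pose K := K_mx R G; pose S := S_mx (fun a : sym_arc G => g (val a)).
pose T := K *m S *m K ^t*.
have T_herm : (2 *: T) ^t* = 2 *: T.
  by rewrite linearZ map_mxZ /= conjC_nat (discriminant_hermitian g_odd).
have int_eig (a : R[i]) (v : 'rV_#|G|) :
    v != 0 -> v *m (2 *: T) = a *: v -> algebraic_integer a.
  move=> v_neq0 vT; have -> : a = 2 * (a / 2) by rewrite mulrC divfK ?pnatr_eq0.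
  have {}vT : v *m T = (a / 2) *: v.
    apply: (scalerI (a := 2)); first by rewrite pnatr_eq0.
    by rewrite scalemxAr vT scalerA mulrCA mulfV ?mulr1 ?pnatr_eq0.
  exact: (walk_eigenvalue_lift (K_mx_coisometry R deg_gt0)
           (S_mx_involutive g_odd) tau_gt0 Utau v_neq0 vT).
have [e int_e eE] := half_trace_sqr_integral T_herm int_eig.
apply: (@algebraic_integer_ratio_dvdn R[i]) => //.
suff -> : (2 * #|G|)%:R / k%:R = - e by apply: integral_opp.
have k_neq0 : k%:R != 0 :> R[i] by rewrite pnatr_eq0 -lt0n.
have trTT : \tr (T *m T) = #|G|%:R / k%:R.
  rewrite (discriminant_sqr_trace g_odd).
  rewrite (eq_bigr (fun=> k%:R^-1)) => [|x _].
    by rewrite sumr_const cardT -cardE -[LHS]mulr_natl.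
  rewrite (eq_bigr (fun=> k%:R^-1 * k%:R^-1)) => [|y _]; last by rewrite !degE.
  have degxE : #|[pred y | adj x y]| = k by rewrite -(degE x) /deg cardsE.
  by rewrite sumr_const degxE -[LHS]mulr_natl mulVKf.
apply: (mulfI (x := 2)); first by rewrite pnatr_eq0.
rewrite mulrN -eE linearZ /= discriminant_trace mulr0 expr0n /= sub0r opprK.
rewrite -scalemxAl -scalemxAr !linearZ /= trTT natrM.
by rewrite -!mulrA.
Qed.

(** * Hamming graphs *)

(** A neighbour of u is determined by the coordinate at which it differs from u
    and by its new letter there. *)
Lemma card_hamming_sphere (d q : nat) (u : word d q) :
  #|[set v | hamming_adj u v]| = (d * q.-1)%N.
Proof.
pose A := [set p : 'I_d * 'I_q | p.2 != u p.1].
pose m (p : 'I_d * 'I_q) : word d q :=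
  [ffun j => if j == p.1 then p.2 else u j].
have diff_m p : p \in A -> [set i | u i != m p i] = [set p.1].
  rewrite inE => pA; apply/setP => i; rewrite !inE ffunE.
  by have [->|_] := eqVneq i p.1; rewrite ?eqxx // eq_sym.
have m_inj : {in A &, injective m}.
  move=> p r pA rA mE; have /set1_inj E1 : [set p.1] = [set r.1].
    by rewrite -!diff_m // mE.
  move/ffunP/(_ p.1): mE; rewrite !ffunE E1 eqxx => E2.
  by rewrite [p]surjective_pairing E1 E2 -surjective_pairing.
have -> : [set v | hamming_adj u v] = m @: A.
  apply/setP => v; rewrite inE; apply/idP/imsetP => [/cards1P[i iE]|[p pA ->]].
    have uv j : (u j != v j) = (j == i).
      by move/setP/(_ j): iE; rewrite !inE.
    exists (i, v i); first by rewrite inE /= eq_sym uv.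
    apply/ffunP => j; rewrite ffunE /=; case: eqVneq => [->//|].
    by rewrite -uv negbK => /eqP.
  by rewrite /hamming_adj diff_m // cards1.
rewrite card_in_imset // -sum1_card.
transitivity (\sum_i \sum_(c | c != u i) 1)%N.
  by rewrite pair_big_dep; apply: eq_bigl => -[i c]; rewrite inE.
rewrite (eq_bigr (fun=> q.-1)) => [|i _]; first by rewrite sum_nat_const card_ord.
by rewrite sum1_card -[q in RHS]card_ord -(cardC1 (u i)).
Qed.

Lemma mixed_hamming_deg (d q : nat) (G : mixed_graph) (x : G) :
  mixed_hamming d q G -> deg x = (d * q.-1)%N.
Proof.
case=> f [f' fK f'K] fE; rewrite -(card_hamming_sphere (f x)) /deg.
rewrite -(card_imset _ (can_inj fK)); apply: eq_card => v.
by rewrite -[v]f'K mem_imset ?inE ?fE //; apply: can_inj fK.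
Qed.

Lemma mixed_hamming_card (d q : nat) (G : mixed_graph) :
  mixed_hamming d q G -> #|G| = (q ^ d)%N.
Proof. by case=> f /bij_eq_card-> _; rewrite card_ffun !card_ord. Qed.

(** The consecutive integers q - 1 and q are coprime, so q - 1 divides 2. *)
Lemma hamming_parameters (d q : nat) :
    (1 <= d)%N -> (2 <= q)%N -> (d * q.-1 %| 2 * q ^ d)%N ->
  exists f : nat, (d, q) = ((2 ^ f)%N, 2%N) \/ (d, q) = ((3 ^ f)%N, 3%N).
Proof.
(* From here on, the alphabet has q.+1 letters. *)
case: q => // q d_gt0; rewrite ltnS /= => q_gt0 dvd_dq.
have : (q %| 2)%N.
  rewrite -(@Gauss_dvdl _ _ (q.+1 ^ d)%N).
    exact: dvdn_trans (dvdn_mull _ _) dvd_dq.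
  by rewrite coprimeXr // coprimenS.
rewrite dvdn_divisors // !inE => /orP[] /eqP q_eq; move: dvd_dq; rewrite q_eq.
  rewrite muln1 -expnS => /(dvdn_pfactor _ _ (isT : prime 2))[f _ ->].
  by exists f; left.
rewrite mulnC dvdn_pmul2l // => /(dvdn_pfactor _ _ (isT : prime 3))[f _ ->].
by exists f; right.
Qed.

Theorem proposition7p2 (R : realType) (eta : R) (heta0 : 0 <= eta)
    (heta2pi : eta < 2 * pi) (d q : nat) (hd : (1 <= d)%N) (hq : (2 <= q)%N)
    (G : mixed_graph) (hG : mixed_hamming d q G)
    (hper : periodic (@eta_function R G eta)) :
  exists f : nat,
    (d, q) = ((2 ^ f)%N, 2%N) \/ (d, q) = ((3 ^ f)%N, 3%N).
Proof.
apply: hamming_parameters => //; rewrite -(mixed_hamming_card hG).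
apply: periodic_regular_dvdn hper => [|x]; last exact: mixed_hamming_deg.
by rewrite muln_gt0 hd -ltnS prednK // (ltn_trans _ hq).
Qed.
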